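(* Let $\mathbf{A}\in\mathbb{C}^{n\times n}$ with $\operatorname{Ind}\mathbf{A}=k$ and $\operatorname{rank}\mathbf{A}^{k+1}=\operatorname{rank}\mathbf{A}^{k}=r\le n$, where $r\ge1$. Then $$\mathbf{A}^{D}\mathbf{A}=\left(\frac{v_{ij}}{d_{r}(\mathbf{A}^{k+1})}\right)_{n\times n},\qquad v_{ij}=\sum_{\beta\in J_{r,n}\{i\}}\left|\left(\mathbf{A}^{k+1}_{.\,i}(\mathbf{a}^{(k+1)}_{.j})\right)^{\beta}_{\beta}\right|\quad\text{for all } i,j=1,\dots,n.$$
   Context: $\operatorname{Ind}\mathbf{A}$ is the least integer $k\ge0$ such that $\operatorname{rank}\mathbf{A}^{k+1}=\operatorname{rank}\mathbf{A}^{k}$ (with $\mathbf{A}^0=\mathbf{I}$). If $\operatorname{Ind}\mathbf{A}=k$, the Drazin inverse $\mathbf{A}^{D}$ is the unique matrix $\mathbf{X}$ with $\mathbf{A}^{k+1}\mathbf{X}=\mathbf{A}^{k}$, $\mathbf{X}\mathbf{A}\mathbf{X}=\mathbf{X}$, $\mathbf{A}\mathbf{X}=\mathbf{X}\mathbf{A}$. $\mathbf{a}^{(k+1)}_{.j}$ denotes the $j$th column of $\mathbf{A}^{k+1}$. $\mathbf{A}^{k+1}_{.\,i}(\mathbf{b})$ is the matrix obtained from $\mathbf{A}^{k+1}$ by replacing its $i$th column by the column vector $\mathbf{b}$. For $1\le r\le n$, $J_{r,n}$ is the set of all strictly increasing sequences of $r$ integers chosen from $\{1,\dots,n\}$, and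 $J_{r,n}\{i\}$ is the set of those $\beta\in J_{r,n}$ containing $i$. $|\mathbf{B}^{\beta}_{\beta}|$ is the principal minor of the square matrix $\mathbf{B}$ with rows and columns indexed by $\beta$. $d_{r}(\mathbf{A}^{k+1})=\sum_{\beta\in J_{r,n}}|(\mathbf{A}^{k+1})^{\beta}_{\beta}|$. *)

(* Defs.v *)
From mathcomp Require Import all_boot all_order all_algebra.
From mathcomp Require Export reals complex.

Set Implicit Arguments.
Unset Strict Implicit.
Unset Printing Implicit Defensive.

Import GRing.Theory.
Local Open Scope ring_scope.

Section Drazin.

Variables (F : fieldType) (n : nat).
Implicit Types (A X : 'M[F]_n) (k r : nat).

Definition rank_stable A : pred nat :=
  fun k => \rank (A ^+ k.+1) == \rank (A ^+ k).

Lemma rank_stable_exists A : exists k, rank_stable A k.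
Proof.
have [/existsP[k stk]|/existsPn nst] := boolP [exists k : 'I_n.+1, rank_stable A k].
  by exists k.
have bnd j : (j <= n.+1)%N -> (\rank (A ^+ j) + j <= n)%N.
  elim: j => [_|j IHj ltjn]; first by rewrite addn0 rank_leq_row.
  rewrite addnS (leq_trans _ (IHj (ltnW ltjn))) // ltn_add2r.
  rewrite ltn_neqAle (nst (Ordinal ltjn)) /= exprS.
  exact: mxrankM_maxr.
by have := leq_trans (leq_addl _ _) (bnd _ (leqnn _)); rewrite ltnn.
Qed.

Definition mxindex A : nat := ex_minn (rank_stable_exists A).

(* Boolean so that xchoose applies below. *)
Definition is_drazin A X : bool :=
  let k := mxindex A in
  [&& A ^+ k.+1 *m X == A ^+ k, X *m A *m X == X & A *m X == X *m A].

Lemma is_drazin_exists A : exists X, is_drazin A X.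
Proof.
have /eqP stA : rank_stable A (mxindex A) by rewrite /mxindex; case: ex_minnP.
have [Z AZ] : exists Z, A ^+ mxindex A = Z * A ^+ (mxindex A).+1.
  apply/submxP; rewrite -(mxrank_leqif_sup _) ?stA //.
  by rewrite exprS; apply: submxMl.
have [Y AY] : exists Y, A ^+ mxindex A = A ^+ (mxindex A).+1 * Y.
  have /submxP[Y defY] : ((A ^+ mxindex A)^T <= (A ^+ (mxindex A).+1)^T)%MS.
    rewrite -(mxrank_leqif_sup _) ?mxrank_tr ?stA //.
    by rewrite exprSr -[_ * _]/(_ *m _) trmx_mul; apply: submxMl.
  by exists Y^T; rewrite -[LHS]trmxK defY trmx_mul trmxK.
rewrite /is_drazin /=; set k := mxindex A in stA AZ AY *.
have ZA m : Z ^+ m * A ^+ (m + k) = A ^+ k.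
  elim: m => [|m IHm]; first by rewrite expr0 mul1r.
  rewrite exprSr addSnnS addnC exprD.
  by rewrite -mulrA (mulrA Z) -AZ -exprD addnC.
have YA m : A ^+ (k + m) * Y ^+ m = A ^+ k.
  elim: m => [|m IHm]; first by rewrite expr0 mulr1 addn0.
  rewrite addnS -addSn addnC exprD (exprS Y).
  by rewrite -mulrA (mulrA (A ^+ k.+1)) -AY mulrA -exprD addnC.
have ZY m : A ^+ k * Y ^+ m = Z ^+ m * A ^+ k.
  by rewrite -{1}(ZA m) -mulrA addnC YA.
have AX : A * (A ^+ k * Y ^+ k.+1) = A ^+ k * Y ^+ k.
  by rewrite mulrA -exprS (exprS Y) mulrA -AY.
have XA : A ^+ k * Y ^+ k.+1 * A = A ^+ k * Y ^+ k.
  by rewrite !ZY -mulrA -exprSr exprSr -mulrA -AZ.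
exists (A ^+ k * Y ^+ k.+1); apply/and3P; split; apply/eqP.
- by rewrite -[_ *m _]/(_ * _) exprSr -mulrA AX mulrA -exprD YA.
- rewrite -[_ *m _]/(_ * _ * _) XA {1}ZY -!mulrA (mulrA (A ^+ k)) -exprD.
  by rewrite mulrA ZA.
- by rewrite -[LHS]/(_ * _) -[RHS]/(_ * _) AX XA.
Qed.

Definition drazin A : 'M[F]_n := xchoose (is_drazin_exists A).

Lemma drazinP A : is_drazin A (drazin A).
Proof. exact: xchooseP. Qed.

Lemma drazin_uniq A X : is_drazin A X -> X = drazin A.
Proof.
move: (drazin A) (drazinP A) => Y; rewrite /is_drazin /=; set k := mxindex A.
case/and3P=> /eqP AY /eqP YAY /eqP cY /and3P[/eqP AX /eqP XAX /eqP cX].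
have powl m U : U *m A *m U = U -> A *m U = U *m A -> U = A ^+ m * U ^+ m.+1.
  move=> UAU cU; elim: m => [|m IHm]; first by rewrite mul1r.
  have cUm : A * U ^+ m.+1 = U ^+ m.+1 * A by apply: commrX.
  rewrite exprS exprSr -mulrA (mulrA _ _ U) -IHm.
  by rewrite -[RHS]/(A *m (U *m U)) mulmxA cU.
have powr m U : U *m A *m U = U -> A *m U = U *m A -> U = U ^+ m.+1 * A ^+ m.
  move=> UAU cU; rewrite [LHS](powl m) //.
  by apply: commrX; apply/commr_sym; apply: commrX; apply/commr_sym.
have YAk : Y * A ^+ k.+1 = A ^+ k.
  rewrite -AY -[RHS]/(_ * _); apply/commr_sym.
  by apply/commr_sym/commrX/commr_sym.
have XE : X = Y * A * X.
  by rewrite {1}(powl k X XAX cX) -YAk exprS -!mulrA -(powl k X XAX cX).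
have YE : Y = Y * A * X.
  rewrite {1}(powr k Y YAY cY) -AX -[_ *m X]/(_ * X) (exprSr A) !mulrA.
  by rewrite -(powr k Y YAY cY).
by rewrite XE -YE.
Qed.

End Drazin.

Section Minors.

Variables (F : fieldType) (n : nat).
Implicit Types (B : 'M[F]_n) (r : nat) (i j : 'I_n).

Definition incr_seqs r : {set r.-tuple 'I_n} :=
  [set beta : r.-tuple 'I_n | sorted ltn (map val beta)].

Definition incr_seqs_with r i : {set r.-tuple 'I_n} :=
  [set beta in incr_seqs r | i \in beta].

Definition principal_minor r (beta : r.-tuple 'I_n) B : F :=
  \det (mxsub (tnth beta) (tnth beta) B).

Definition sum_principal_minors r B : F :=
  \sum_(beta in incr_seqs r) principal_minor beta B.

Definition replace_col B i (b : 'cV[F]_n) : 'M[F]_n :=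
  \matrix_(p, q) if q == i then b p 0 else B p q.

End Minors.

(* Main.v *)
Require Import Defs.
From mathcomp Require Import all_boot all_order all_algebra.
From mathcomp Require Import reals complex.
From mathcomp Require Import perm.
Import GRing.Theory.

(** Write M for A^(k+1).  A rank factorization M = B C, with B of size n x r
    and C of size r x n, turns every sum of principal minors in the statement
    into one determinant of order r: by the Cauchy-Binet formula, the sum of
    the principal r-minors of B X is det (X B) for every r x n matrix X
    ([sum_principal_minors_mul]).  In particular d_r(M) = det G, where G = C B.

    The matrix A^D A is idempotent, fixes M on the left, and is a left multiple
    of M ([drazin_projector]).  Together with the full ranks of B and C this
    forces G to be invertible and A^D A = B G^-1 C ([idempotent_factored]).

    Let S be the identity matrix with its i-th diagonal entry erased, and E_ji
    the matrix unit.  Replacing column i of M by its column j amounts to right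
    multiplication by S + E_ji, and restricting to the index sets that contain
    i amounts to subtracting the minors of M S, because those of M S vanish on
    these index sets and agree with the minors of M elsewhere.  Hence

      v_ij = det (C (S + E_ji) B) - det (C S B).

    With c_p the p-th column of C and b_i the i-th row of B, both matrices are
    rank-one perturbations of G, namely G + (c_j - c_i) b_i and G - c_i b_i, so
    the matrix determinant lemma ([det_add_col_row]) gives
    v_ij = det G * (b_i G^-1 c_j), which is d_r(M) times the (i, j) entry of
    A^D A. *)

Local Open Scope ring_scope.

Lemma incr_seq_sorted n r (beta : r.-tuple 'I_n) :
  (beta \in incr_seqs n r) = sorted (fun p q : 'I_n => (p < q)%N) beta.
Proof. by rewrite inE sorted_map. Qed.

Lemma incr_seq_inj n r (beta : r.-tuple 'I_n) :
  beta \in incr_seqs n r -> injective (tnth beta).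
Proof.
rewrite inE => sorted_beta; apply/tuple_uniqP.
by rewrite -(map_inj_uniq val_inj) (sorted_uniq ltn_trans ltnn).
Qed.

Lemma incr_seq_mem_eq n r (beta gamma : r.-tuple 'I_n) :
  beta \in incr_seqs n r -> gamma \in incr_seqs n r -> beta =i gamma ->
  beta = gamma.
Proof.
rewrite !incr_seq_sorted => sb sg eq_bg; apply/val_inj.
apply: (irr_sorted_eq (leT := fun p q : 'I_n => (p < q)%N)) sb sg eq_bg.
  by move=> p q s; apply: ltn_trans.
by move=> p; rewrite ltnn.
Qed.

Definition incr_seq_perm n r (u : r.-tuple 'I_n * 'S_r) : {ffun 'I_r -> 'I_n} :=
  [ffun i => tnth u.1 (u.2 i)].

(** The increasing sequence is recovered from the image of the map, since a
    sorted sequence is determined by its elements; the permutation is then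
    recovered because the sequence has no repetition. *)
Lemma incr_seq_perm_inj n r :
  {in setX (incr_seqs n r) [set: 'S_r] &, injective (@incr_seq_perm n r)}.
Proof.
have sub (u w : r.-tuple 'I_n * 'S_r) :
    incr_seq_perm n r u = incr_seq_perm n r w -> {subset u.1 <= w.1}.
  move=> eq_uw p /tnthP[i ->]; move/ffunP/(_ ((u.2)^-1 i)%g): eq_uw.
  by rewrite !ffunE permKV => ->; apply: mem_tnth.
move=> [beta s] [gamma t]; rewrite !in_setX !in_setT !andbT /= => sb sg eq_h.
have eq_bg : beta = gamma.
  apply: incr_seq_mem_eq sb sg _ => p; apply/idP/idP; first exact: (sub _ _ eq_h).
  exact: (sub _ _ (esym eq_h)).
subst gamma; congr pair; apply/permP=> i.
move/ffunP/(_ i): eq_h; rewrite !ffunE /=; exact: incr_seq_inj.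
Qed.

(** Sorting the list of values of an injective map yields the increasing
    sequence, and the permutation undoes the sorting.  With the preceding
    lemma, injective maps are thus parametrized bijectively by such pairs,
    which is how they are grouped in the Cauchy-Binet formula. *)
Lemma incr_seq_perm_image n r :
  incr_seq_perm n r @: setX (incr_seqs n r) [set: 'S_r]
    = [set f : {ffun 'I_r -> 'I_n} | injectiveb f].
Proof.
apply/setP=> f; rewrite inE; apply/imsetP/injectiveP.
  move=> [[beta s]]; rewrite in_setX /= => /andP[/incr_seq_inj inj_beta _] -> i j.
  by rewrite !ffunE => /inj_beta/perm_inj.
move=> inj_f; pose leI (p q : 'I_n) := (p <= q)%N.
have size_sort_f : size (sort leI (codom f)) == r.
  by rewrite size_sort size_codom card_ord.
pose beta : r.-tuple 'I_n := Tuple size_sort_f.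
have /tuple_permP[s def_f] : perm_eq (codom f) beta.
  by rewrite /= perm_sym perm_sort.
exists (beta, s).
  rewrite in_setX in_setT andbT inE -sort_map ltn_sorted_uniq_leq.
  rewrite sort_uniq (map_inj_uniq val_inj) sort_sorted; last exact: leq_total.
  by rewrite andbT; apply/injectiveP.
apply/ffunP=> i; rewrite ffunE /=.
have -> : f i = nth (f i) (codom f) i.
  by rewrite (nth_map i) ?nth_ord_enum // size_enum_ord.
by rewrite def_f -tnth_nth tnth_mktuple.
Qed.

(** Expand each entry of the product inside the Leibniz formula, distribute the
    product over the sums, and exchange the sum over permutations with the sum
    over the maps that pick one summand per factor. *)
Lemma det_mulmx_sum_maps (R : comNzRingType) n r
    (X : 'M[R]_(r, n)) (Y : 'M[R]_(n, r)) :
  \det (X *m Y) =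
    \sum_(f : {ffun 'I_r -> 'I_n}) (\prod_i X i (f i)) * \det (rowsub f Y).
Proof.
rewrite /determinant.
under eq_bigr => s _.
  under eq_bigr do rewrite mxE.
  rewrite bigA_distr_bigA big_distrr /=.
  over.
rewrite exchange_big; apply: eq_bigr => f _ /=; rewrite big_distrr.
apply: eq_bigr => s _ /=; rewrite big_split /= mulrCA; congr (_ * (_ * _)).
by apply: eq_bigr => i _; rewrite mxE.
Qed.

(** In the expansion over all maps f, the maps that are not injective drop out
    because two rows of [rowsub f Y] coincide.  The injective maps with a given
    image beta are the composites of beta with a permutation s; moving s out of
    the determinant of the rows of Y leaves its sign, and summing over s
    rebuilds the determinant of the columns of X. *)
Lemma Cauchy_Binet (R : comNzRingType) n r
    (X : 'M[R]_(r, n)) (Y : 'M[R]_(n, r)) :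
  \det (X *m Y) = \sum_(beta in incr_seqs n r)
     \det (colsub (tnth beta) X) * \det (rowsub (tnth beta) Y).
Proof.
rewrite det_mulmx_sum_maps (bigID (fun f : {ffun _ -> _} => injectiveb f)) /=.
rewrite [X in _ + X]big1 => [|f /injectivePn[i [j neq_ij eq_f]]]; last first.
  rewrite (determinant_alternate neq_ij) ?mulr0 // => k.
  by rewrite !mxE eq_f.
rewrite addr0.
under eq_bigl do rewrite -[injectiveb _](in_set (fun f : {ffun _ -> _} => injectiveb f)).
rewrite -incr_seq_perm_image.
rewrite big_imset /=; last exact: incr_seq_perm_inj.
under [RHS]eq_bigr do rewrite big_distrl /=.
rewrite pair_big /=; apply: eq_big => [u|[beta s] _] /=.
  by case: u => beta s; rewrite in_setX in_setT.
have -> : rowsub (incr_seq_perm n r (beta, s)) Y = row_perm s (rowsub (tnth beta) Y).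
  by apply/matrixP=> i j; rewrite !mxE ffunE.
rewrite row_permE det_mulmx det_perm mulrA mulrC [RHS]mulrC [in LHS](mulrC (\prod_i _)).
congr (_ * (_ * _)).
by apply: eq_bigr => i _; rewrite !mxE ffunE.
Qed.

(** The principal minor of Y X on beta factors as the minor of the rows beta of
    Y times the minor of the columns beta of X: this is the Cauchy-Binet
    expansion of the product in the other order. *)
Lemma sum_principal_minors_mul (F : fieldType) n r
    (Y : 'M[F]_(n, r)) (X : 'M[F]_(r, n)) :
  sum_principal_minors r (Y *m X) = \det (X *m Y).
Proof.
rewrite Cauchy_Binet; apply: eq_bigr => beta _.
by rewrite /principal_minor mxsub_mul det_mulmx mulrC.
Qed.

(** The matrix determinant lemma.  Factoring out G reduces it to
    det (1 + u a) = 1 + a u, which compares the determinants of the upper and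
    lower triangular block factorizations of one matrix. *)
Lemma det_add_col_row (F : fieldType) r (G : 'M[F]_r) (u : 'cV[F]_r) (v : 'rV[F]_r) :
  G \in unitmx ->
  \det (G + u *m v) = \det G * (1 + (v *m invmx G *m u) 0 0).
Proof.
move=> uG; pose a := v *m invmx G.
have -> : G + u *m v = (1%:M + u *m a) *m G.
  by rewrite mulmxDl mul1mx /a -!mulmxA mulVmx ?mulmx1.
rewrite det_mulmx mulrC; congr (_ * _).
have -> : 1 + (a *m u) 0 0 = \det (1%:M + a *m u) by rewrite det_mx11 !mxE.
(* Both products below equal the matrix K, whose Schur complements with respect
   to its two diagonal blocks are 1 + a u and 1 + u a. *)
pose L : 'M_(r + 1) := block_mx 1%:M 0 (- a) 1%:M.
pose K : 'M_(r + 1) := block_mx 1%:M u (- a) 1%:M.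
have eqL : L *m block_mx 1%:M u 0 (1%:M + a *m u) = K.
  rewrite mulmx_block !mul1mx !mul0mx !mulmx1 !addr0 !mulNmx.
  by rewrite addrC addrK.
have eqR : block_mx (1%:M + u *m a) u 0 1%:M *m L = K.
  rewrite mulmx_block !mulmx1 !mul0mx !mulmx0 !mul1mx !add0r.
  by rewrite mulmxN addrK.
have := congr1 determinant (etrans eqL (esym eqR)).
by rewrite !det_mulmx !det_ublock det_lblock !det1 !mul1r !mulr1.
Qed.

(** The right factor is the identity matrix whose i-th column is replaced by the
    j-th unit vector; writing it with matrix units exposes the rank-one
    perturbations used below. *)
Lemma replace_colE (F : fieldType) n (M : 'M[F]_n) (i j : 'I_n) :
  replace_col M i (col j M) = M *m (1%:M - delta_mx i i + delta_mx j i).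
Proof.
apply/matrixP=> p q; rewrite mulmxDr mulmxBr mulmx1 !mxE.
have mul_delta k : \sum_l M p l * (delta_mx k i : 'M_n) l q = M p k *+ (q == i).
  rewrite (bigD1 k) //= big1 => [|l neq_lk]; last first.
    by rewrite mxE (negPf neq_lk) mulr0.
  by rewrite mxE eqxx addr0 mulr_natr.
rewrite !mul_delta; case: eqP => [->|_]; last by rewrite subr0 addr0.
by rewrite subrr add0r.
Qed.

(** The factor [1%:M - delta_mx i i] erases column i.  A minor of the matrix
    with column i erased is 0 when it involves i; when it does not, it is blind
    to what stands in column i, so that it cancels the minor of the matrix with
    column i replaced. *)
Lemma sum_minors_with_replace_col (F : fieldType) n r (M : 'M[F]_n) (i j : 'I_n) :
  \sum_(beta in incr_seqs_with r i)
      principal_minor beta (replace_col M i (col j M)) =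
  sum_principal_minors r (M *m (1%:M - delta_mx i i + delta_mx j i)) -
  sum_principal_minors r (M *m (1%:M - delta_mx i i)).
Proof.
rewrite -replace_colE.
have MS p q : (M *m (1%:M - delta_mx i i)) p q = if q == i then 0 else M p q.
  rewrite mulmxBr mulmx1 !mxE (bigD1 i) //= big1 => [|l neq_li]; last first.
    by rewrite mxE (negPf neq_li) mulr0.
  by rewrite mxE eqxx addr0 mulr_natr /=; case: eqP => [->|]; rewrite ?subrr ?subr0.
rewrite /sum_principal_minors -sumrB [RHS](bigID (fun beta => i \in val beta)) /=.
rewrite [X in _ = _ + X]big1 ?addr0 => [|beta /andP[_ i_notin]].
  apply: eq_big => [beta|beta]; first by rewrite inE.
  rewrite inE => /andP[_ /tnthP[l def_i]].
  suff -> : principal_minor beta (M *m (1%:M - delta_mx i i)) = 0 by rewrite subr0.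
  rewrite /principal_minor (expand_det_col _ l) big1 // => p _.
  by rewrite mxE MS -def_i eqxx mul0r.
apply/eqP; rewrite subr_eq0; apply/eqP; congr determinant.
apply/matrixP=> p q; rewrite 2![in LHS]mxE [RHS]mxE MS.
case: eqP => // eq_i; case/negP: i_notin; rewrite -eq_i; exact: mem_tnth.
Qed.

(** Both sums of minors become determinants of rank-one perturbations of C B
    along the same row of B, so in the difference of the two matrix determinant
    formulas the contributions of column i of C cancel. *)
Lemma sum_minors_replace_col_factored (F : fieldType) n r
    (B : 'M[F]_(n, r)) (C : 'M[F]_(r, n)) (i j : 'I_n) :
  C *m B \in unitmx ->
  \sum_(beta in incr_seqs_with r i)
      principal_minor beta (replace_col (B *m C) i (col j (B *m C))) =
  \det (C *m B) * (B *m invmx (C *m B) *m C) i j.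
Proof.
move=> uG; have -> : (B *m invmx (C *m B) *m C) i j =
    (row i B *m invmx (C *m B) *m col j C) 0 0.
  by rewrite -row_mul !mxE; apply: eq_bigr => l _; rewrite !mxE.
rewrite sum_minors_with_replace_col -!(mulmxA B) !sum_principal_minors_mul.
have CdB k : C *m delta_mx k i *m B = col k C *m row i B.
  by rewrite colE rowE !mulmxA -[in RHS](mulmxA C) mul_delta_mx.
rewrite !(mulmxDr, mulmxDl, mulmxN, mulNmx, mulmx1) !CdB.
rewrite -addrA -!mulNmx -mulmxDl !det_add_col_row //.
rewrite -mulrBr; congr (_ * _).
by rewrite opprD addrACA subrr add0r mulmxDr [(_ + _ : 'M_1) 0 0]mxE addrC addKr.
Qed.

(** Cancelling C in P B C = B C gives P B = B, that is (U B) (C B) = B.  Since B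
    has a left inverse, so has C B, and then U B = B (C B)^-1. *)
Lemma idempotent_factored (F : fieldType) n r
    (B : 'M[F]_(n, r)) (C : 'M[F]_(r, n)) (P U : 'M[F]_n) :
  row_free C -> row_full B ->
  P *m (B *m C) = B *m C -> P = U *m (B *m C) ->
  C *m B \in unitmx /\ P = B *m invmx (C *m B) *m C.
Proof.
move=> freeC fullB PM defP.
have PB : P *m B = B by apply: (row_free_inj freeC); rewrite /= -mulmxA.
have UG : U *m B *m (C *m B) = B by rewrite -[RHS]PB defP !mulmxA.
have uG : C *m B \in unitmx.
  have /row_fullP[L LB] := fullB.
  suff /mulmx1_unit[] : L *m (U *m B) *m (C *m B) = 1%:M by [].
  by rewrite -mulmxA UG.
split=> //; have <- : U *m B = B *m invmx (C *m B) by rewrite -[LHS](mulmxK uG) UG.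
by rewrite defP mulmxA.
Qed.

(** Since A commutes with its Drazin inverse X and X A is idempotent,
    X A = (X A)^(k+1) = X^(k+1) A^(k+1). *)
Lemma drazin_projector (F : fieldType) n (A : 'M[F]_n) :
  let k := mxindex A in
  drazin A *m A *m A ^+ k.+1 = A ^+ k.+1
  /\ exists U, drazin A *m A = U *m A ^+ k.+1.
Proof.
move=> k; have /and3P[/eqP AX /eqP XAX /eqP cX] := drazinP A.
move: (drazin A) AX XAX cX => X AX XAX cX.
have cAX : GRing.comm A X := cX.
have XAk : X *m A ^+ k.+1 = A ^+ k by rewrite -[RHS]AX; apply: commrX.
split; first by rewrite -[X *m A]cX -mulmxA XAk -[LHS]/(_ * _) -exprS.
exists (X ^+ k.+1).
have idemP m : (X * A) ^+ m.+1 = X * A.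
  by elim: m => [|m IHm]; rewrite ?expr1 // exprS IHm mulrA; congr (_ * _).
by rewrite -[LHS](idemP k) exprMn_comm //; apply: commr_sym.
Qed.

Theorem corollary3p2 (R : realType) (n k r : nat) (A : 'M[R[i]]_n)
    (indA : mxindex A = k)
    (rankAk1 : \rank (A ^+ k.+1) = r) (rankAk : \rank (A ^+ k) = r)
    (r_le_n : (r <= n)%N) (r_ge1 : (1 <= r)%N) :
  let v (i j : 'I_n) : R[i] :=
    \sum_(beta in incr_seqs_with r i)
      principal_minor beta (replace_col (A ^+ k.+1) i (col j (A ^+ k.+1))) in
  drazin A *m A =
    \matrix_(i < n, j < n) (v i j / sum_principal_minors r (A ^+ k.+1)).
Proof.
move=> v; rewrite {}/v.
have := drazin_projector R[i] n A; rewrite /= indA => -[PM [U defP]].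
have [B [C [defM freeC fullB]]] : exists (B : 'M_(n, r)) (C : 'M_(r, n)),
    [/\ A ^+ k.+1 = B *m C, row_free C & row_full B].
  subst r; exists (col_base (A ^+ k.+1)), (row_base (A ^+ k.+1)).
  by rewrite mulmx_base row_base_free col_base_full.
rewrite {}defM in PM defP *.
have [uG ->] := idempotent_factored _ _ _ B C _ U freeC fullB PM defP.
apply/matrixP=> i j; rewrite [RHS]mxE.
rewrite sum_minors_replace_col_factored // sum_principal_minors_mul.
by rewrite mulrC mulKf // -unitfE -unitmxE.
Qed.
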